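(* Let $\alpha = 1$ or $\alpha = 2$. For each integer $n \ge 2$, let $\boldsymbol{A}, \boldsymbol{B}, \boldsymbol{C}$ be independently drawn from the uniform distribution on the unit sphere $\mathbb{S}_n = \{\boldsymbol{A} \in \mathbb{M}_n(\mathbb{R}) : \|\boldsymbol{A}\|_{\mathrm{F}} = 1\}$. Then $$\lim_{n\to\infty} \mathrm{P}\left(\Delta_{\alpha}(\boldsymbol{A},\boldsymbol{B},\boldsymbol{C}) < 0\right) = 0.$$
   Context: $\mathbb{M}_n(\mathbb{R})$ is the space of real $n\times n$ matrices, and $\|\boldsymbol{M}\|_{\mathrm{F}} = \left(\sum_{i,j} m_{ij}^2\right)^{1/2}$ is the Frobenius norm. The uniform distribution on $\mathbb{S}_n$ is the normalized surface (rotation-invariant) probability measure on $\mathbb{S}_n$ viewed as the Euclidean unit sphere in $\mathbb{R}^{n^2}$. For $\alpha > 0$, define $d_{\alpha}(\boldsymbol{A},\boldsymbol{B}) = \|\boldsymbol{A}\boldsymbol{B} - \boldsymbol{B}\boldsymbol{A}\|_{\mathrm{F}}^{\alpha}$ and the triangle inequality defect $$\Delta_{\alpha}(\boldsymbol{A},\boldsymbol{B},\boldsymbol{C}) = d_{\alpha}(\boldsymbol{A},\boldsymbol{B}) + d_{\alpha}(\boldsymbol{B},\boldsymbol{C}) - d_{\alpha}(\boldsymbol{A},\boldsymbol{C}).$$ *)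

(* Defs.v *)
From mathcomp Require Import all_boot all_order all_algebra.
From mathcomp Require Import all_classical all_reals all_analysis.

Set Implicit Arguments.
Unset Strict Implicit.
Unset Printing Implicit Defensive.

Import Order.TTheory GRing.Theory Num.Theory.
Import numFieldNormedType.Exports.

Local Open Scope classical_set_scope.
Local Open Scope ring_scope.

(* The library's norm on matrices, `|M|, is the sup norm. *)
Definition frob_norm (R : realType) (n : nat) (M : 'M[R]_n) : R :=
  Num.sqrt (\sum_(i < n) \sum_(j < n) M i j ^+ 2).

Definition frob_sphere (R : realType) (n : nat) : set 'M[R]_n :=
  [set M | frob_norm M = 1].

Definition comm_dist (R : realType) (n : nat) (alpha : R) (A B : 'M[R]_n) : R :=
  frob_norm (A *m B - B *m A) `^ alpha.

Definition triangle_defect (R : realType) (n : nat) (alpha : R)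
    (A B C : 'M[R]_n) : R :=
  comm_dist alpha A B + comm_dist alpha B C - comm_dist alpha A C.

(* 'M[R]_n with the Borel sigma-algebra of its entrywise (hence Euclidean)
   topology. *)
Definition borel_mx (R : realType) (n : nat) :=
  g_sigma_algebraType (@open 'M[R]_n).

(* The uniform distribution on the Frobenius unit sphere, characterized as the
   Borel probability measure on matrices which is carried by the sphere and
   invariant under the orthogonal group of R^(n^2), i.e., under all linear
   isometries of the Frobenius norm; this determines it uniquely when 0 < n.
   No such measure exists for n = 0, where the sphere is empty. *)
Definition is_uniform_sphere (R : realType) (n : nat)
    (mu : probability (borel_mx R n) R) : Prop :=
  mu (@frob_sphere R n) = 1%E /\
  forall Q : {linear 'M[R]_n -> 'M[R]_n},
    (forall M, frob_norm (Q M) = frob_norm M) ->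
    forall E : set (borel_mx R n), measurable E -> mu (Q @^-1` E) = mu E.

(* Taking some of the sets to be setT gives the product rule for subfamilies. *)
Definition independent3 d d' (T : measurableType d) (T' : measurableType d')
    (R : realType) (P : probability T R) (X Y Z : {RV P >-> T'}) : Prop :=
  forall E F G : set T', measurable E -> measurable F -> measurable G ->
    P (X @^-1` E `&` Y @^-1` F `&` Z @^-1` G) =
    (P (X @^-1` E) * P (Y @^-1` F) * P (Z @^-1` G))%E.

(* Main.v *)
(* Fix B on the sphere and write q(A) = |AB - BA|^2 as a quadratic form in A
   with Gram matrix S. Invariance under Householder reflections forces the
   fourth moment tensor of the sphere to be
     E x_p x_q x_r x_s = m ([p=q][r=s] + [p=r][q=s] + [p=s][q=r]),
   m N (N + 2) = 1, N = n^2. Since tr S = 2n - 2 (tr B)^2 and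
   tr S^2 <= 4 tr S, this gives E_A (q - 2/n)^2 <= (4 (tr B)^2 + 16) / n^3. By
   Chebyshev's inequality and integration over B, using E (tr B)^2 = 1/n, each
   n |AB - BA|^2 lies within 1/2 of 2 except on an event of probability O(1/n),
   whereas a negative defect implies |AB - BA|^2 + |BC - CB|^2 < |AC - CA|^2
   for alpha = 1 as well as for alpha = 2. *)
Require Import Defs.
From HB Require Import structures.
From mathcomp Require Import all_boot all_order all_algebra.
From mathcomp Require Import ring lra measurable_realfun.
From mathcomp Require Import all_classical all_reals all_analysis.

Set Implicit Arguments.
Unset Strict Implicit.
Unset Printing Implicit Defensive.

Import Order.TTheory GRing.Theory Num.Theory.
Import numFieldNormedType.Exports.

Local Open Scope classical_set_scope.
Local Open Scope ring_scope.

(** * Frobenius inner product and the quadratic form of the commutator *)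

(** Lagrange's identity: twice the gap is the double sum of the squares
    [(a i * b j - a j * b i) ^+ 2]. *)
Lemma sum_mul_sqr_le (R : realFieldType) (I : finType) (a b : I -> R) :
  (\sum_i a i * b i) ^+ 2 <= (\sum_i a i ^+ 2) * (\sum_i b i ^+ 2).
Proof.
suff: 0 <= (\sum_i a i ^+ 2) * (\sum_i b i ^+ 2) *+ 2
           - (\sum_i a i * b i) ^+ 2 *+ 2.
  by rewrite -mulrnBl pmulrn_lge0// subr_ge0.
have -> : (\sum_i a i ^+ 2) * (\sum_i b i ^+ 2) *+ 2
    - (\sum_i a i * b i) ^+ 2 *+ 2 =
    \sum_i \sum_j (a i * b j - a j * b i) ^+ 2.
  rewrite [LHS](_ : _ = (\sum_i a i ^+ 2) * (\sum_j b j ^+ 2)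
     + (\sum_i b i ^+ 2) * (\sum_j a j ^+ 2)
     - (\sum_i a i * b i) * (\sum_j a j * b j) *+ 2); last by ring.
  rewrite !big_distrlr/= -sumrMnl -big_split -sumrB/=.
  apply: eq_bigr => i _; rewrite -sumrMnl -big_split -sumrB/=.
  by apply: eq_bigr => j _; ring.
by apply: sumr_ge0 => i _; apply: sumr_ge0 => j _; exact: sqr_ge0.
Qed.

(** Indexing by pairs treats a matrix as a vector of R^(n^2), each pair being one coordinate. *)
Definition frob_dot (R : pzRingType) (n : nat) (M N : 'M[R]_n) : R :=
  \sum_(p : 'I_n * 'I_n) M p.1 p.2 * N p.1 p.2.

Definition lie_mx (R : pzRingType) (n : nat) (A B : 'M[R]_n) : 'M[R]_n :=
  A *m B - B *m A.

Definition mx_unit (R : pzRingType) (n : nat) (p : 'I_n * 'I_n) : 'M[R]_n :=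
  delta_mx p.1 p.2.

Lemma frob_dotE (R : comPzRingType) (n : nat) (M N : 'M[R]_n) :
  frob_dot M N = \tr (M *m N^T).
Proof.
rewrite /frob_dot -(pair_bigA _ (fun i j => M i j * N i j))/=.
by apply: eq_bigr => i _; rewrite mxE; apply: eq_bigr => j _; rewrite mxE.
Qed.

Lemma frob_dotC (R : comPzRingType) (n : nat) (M N : 'M[R]_n) :
  frob_dot M N = frob_dot N M.
Proof. by apply: eq_bigr => p _; rewrite mulrC. Qed.

Lemma frob_dotDr (R : pzRingType) (n : nat) (M N P : 'M[R]_n) :
  frob_dot M (N + P) = frob_dot M N + frob_dot M P.
Proof.
by rewrite -big_split; apply: eq_bigr => p _; rewrite /= mxE mulrDr.
Qed.

Lemma frob_dotZr (R : comPzRingType) (n : nat) (a : R) (M N : 'M[R]_n) :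
  frob_dot M (a *: N) = a * frob_dot M N.
Proof.
by rewrite mulr_sumr; apply: eq_bigr => p _; rewrite mxE mulrCA.
Qed.

Lemma frob_dot_ge0 (R : realFieldType) (n : nat) (M : 'M[R]_n) :
  0 <= frob_dot M M.
Proof. by apply: sumr_ge0 => p _; rewrite -expr2 sqr_ge0. Qed.

Lemma frob_normE (R : realType) (n : nat) (M : 'M[R]_n) :
  frob_norm M = Num.sqrt (frob_dot M M).
Proof.
by rewrite /frob_norm pair_bigA; congr Num.sqrt; apply: eq_bigr.
Qed.

Lemma sqr_frob_norm (R : realType) (n : nat) (M : 'M[R]_n) :
  frob_norm M ^+ 2 = frob_dot M M.
Proof. by rewrite frob_normE sqr_sqrtr// frob_dot_ge0. Qed.

Lemma frob_dot_delta (R : pzRingType) (n : nat) (M : 'M[R]_n) p :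
  frob_dot M (mx_unit R p) = M p.1 p.2.
Proof.
rewrite /frob_dot (bigD1 p)//= big1 => [|q qp].
  by rewrite mxE !eqxx mulr1 addr0.
rewrite mxE; case: eqP => [e1|]; last by rewrite mulr0.
case: eqP => [e2|]; last by rewrite mulr0.
by move: qp; rewrite (surjective_pairing p) -e1 -e2 -surjective_pairing eqxx.
Qed.

Lemma frob_dot_trmx (R : pzRingType) (n : nat) (M : 'M[R]_n) :
  frob_dot M^T M^T = frob_dot M M.
Proof.
rewrite /frob_dot -(pair_bigA _ (fun i j => M^T i j * M^T i j))/=.
rewrite exchange_big -[RHS](pair_bigA _ (fun i j => M i j * M i j))/=.
by apply: eq_bigr => i _; apply: eq_bigr => j _; rewrite !mxE.
Qed.

(** By cyclicity of the trace, tr (B A M^T) = tr (A M^T B). So A |-> [A, B] has adjoint M |->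
    [M, B^T]. *)
Lemma lie_mx_adjoint (R : comPzRingType) (n : nat) (A B M : 'M[R]_n) :
  frob_dot (lie_mx A B) M = frob_dot A (lie_mx M B^T).
Proof.
rewrite !frob_dotE /lie_mx [(_ - _)^T]linearB/= !trmx_mul trmxK.
rewrite mulmxBl mulmxBr !linearB/= mulmxA; congr (_ - _).
by rewrite -mulmxA mxtrace_mulC mulmxA.
Qed.

(** Cauchy-Schwarz for each entry, a row of [A] against a column of [B], summed over all entries. *)
Lemma frob_dot_mulmx_le (R : realFieldType) (n : nat) (A B : 'M[R]_n) :
  frob_dot (A *m B) (A *m B) <= frob_dot A A * frob_dot B B.
Proof.
rewrite -(frob_dot_trmx B) /frob_dot.
rewrite -(pair_bigA _ (fun i j => (A *m B) i j * (A *m B) i j))/=.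
rewrite -(pair_bigA _ (fun i j => A i j * A i j))/=.
rewrite -(pair_bigA _ (fun i j => B^T i j * B^T i j))/=.
rewrite big_distrlr/=; apply: ler_sum => i _; apply: ler_sum => j _.
rewrite -expr2 mxE; apply: le_trans (sum_mul_sqr_le _ _) _.
rewrite le_eqVlt; apply/orP; left; apply/eqP.
by congr (_ * _); apply: eq_bigr => k _; rewrite ?mxE ?expr2.
Qed.

(** From |X - Y|^2 <= 2 |X|^2 + 2 |Y|^2 and submultiplicativity for AB and BA, whence 4 = 2 + 2. *)
Lemma lie_mx_bound (R : realFieldType) (n : nat) (A B : 'M[R]_n) :
  frob_dot (lie_mx A B) (lie_mx A B) <= 4 * frob_dot B B * frob_dot A A.
Proof.
have h (X Y : 'M[R]_n) : frob_dot (X - Y) (X - Y) <=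
    2 * frob_dot X X + 2 * frob_dot Y Y.
  rewrite /frob_dot !mulr_sumr -big_split/=; apply: ler_sum => p _.
  rewrite !mxE; move: (X _ _) (Y _ _) => x y.
  have := sqr_ge0 (x + y); nra.
apply: le_trans (h _ _) _.
have := frob_dot_mulmx_le A B; have := frob_dot_mulmx_le B A.
nra.
Qed.

Lemma mulmx_delta_mulmx (R : comPzRingType) (m n p q : nat) (X : 'M[R]_(m, n))
    (Y : 'M[R]_(p, q)) i j k l :
  (X *m delta_mx i j *m Y) k l = X k i * Y j l.
Proof.
(* Factor the matrix unit as a column times a row; the product becomes column [i] of [X] times row
   [j] of [Y]. *)
rewrite -(mul_delta_mx (0 : 'I_1)) mulmxA -mulmxA -colE -rowE mxE big_ord1.
by rewrite !mxE.
Qed.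

(** This is tr S. For a matrix unit E, expand [[E, B], B^T] = E B B^T - B E B^T - B^T E B + B^T B E.
    Summed over all units, the outer terms give n |B|^2 each and the inner ones (tr B)^2 each. *)
Lemma lie_mx_trace (R : comPzRingType) (n : nat) (B : 'M[R]_n) :
  \sum_p frob_dot (lie_mx (mx_unit R p) B) (lie_mx (mx_unit R p) B) =
  n%:R * frob_dot B B *+ 2 - \tr B ^+ 2 *+ 2.
Proof.
have key (p : 'I_n * 'I_n) :
    frob_dot (lie_mx (mx_unit R p) B) (lie_mx (mx_unit R p) B) =
    (B *m B^T) p.2 p.2 + (B^T *m B) p.1 p.1 - B p.1 p.1 * B p.2 p.2 *+ 2.
  rewrite lie_mx_adjoint frob_dotC frob_dot_delta /lie_mx mulmxBl mulmxBr.
  have := mulmx_delta_mulmx 1%:M (B *m B^T) p.1 p.2 p.1 p.2.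
  have := mulmx_delta_mulmx (B^T *m B) 1%:M p.1 p.2 p.1 p.2.
  have := mulmx_delta_mulmx B B^T p.1 p.2 p.1 p.2.
  have := mulmx_delta_mulmx B^T B p.1 p.2 p.1 p.2.
  rewrite -/(mx_unit R p) mul1mx mulmx1 !mulmxA => e1 e2 e3 e4.
  have mxBB (U V W Z : 'M[R]_n) i j :
      (U - V - (W - Z)) i j = U i j - V i j - (W i j - Z i j) by rewrite !mxE.
  have mx1 i : (1%:M : 'M[R]_n) i i = 1 by rewrite mxE eqxx.
  have trE i : B^T i i = B i i by rewrite mxE.
  rewrite mxBB e1 e2 e3 e4 !mx1 !trE; ring.
under eq_bigr do rewrite key.
rewrite frob_dotE !big_split/= sumrN sumrMnl.
rewrite -(pair_bigA _ (fun i j => (B *m B^T) j j))/=.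
rewrite -(pair_bigA _ (fun i j => (B^T *m B) i i))/=.
rewrite -(pair_bigA _ (fun i j => B i i * B j j))/=.
under [X in _ + X - _]eq_bigr do rewrite sumr_const.
under [X in _ - X *+ 2]eq_bigr do rewrite -mulr_sumr.
rewrite -mulr_suml exchange_big/=.
under [X in X + _ - _]eq_bigr do rewrite sumr_const.
rewrite !sumrMnl -!/(mxtrace _) (mxtrace_mulC B^T) card_ord; ring.
Qed.

Definition lie_gram (R : pzRingType) (n : nat) (B : 'M[R]_n)
    (p q : 'I_n * 'I_n) : R :=
  frob_dot (lie_mx (mx_unit R p) B) (lie_mx (mx_unit R q) B).

Lemma lie_gramC (R : comPzRingType) (n : nat) (B : 'M[R]_n) p q :
  lie_gram B p q = lie_gram B q p.
Proof. exact: frob_dotC. Qed.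

Lemma lie_mx_quadratic (R : comPzRingType) (n : nat) (A B : 'M[R]_n) :
  frob_dot (lie_mx A B) (lie_mx A B) =
  \sum_p \sum_q lie_gram B p q * (A p.1 p.2 * A q.1 q.2).
Proof.
(* Linearity in [A] is read off the adjoint: with the bracket moved to [M], only the coordinates of
   [A] remain. *)
have lin M : frob_dot (lie_mx A B) M =
    \sum_p A p.1 p.2 * frob_dot (lie_mx (mx_unit R p) B) M.
  rewrite lie_mx_adjoint; apply: eq_bigr => p _; congr (_ * _).
  by rewrite lie_mx_adjoint frob_dotC frob_dot_delta.
rewrite lin; apply: eq_bigr => p _; rewrite frob_dotC lin mulr_sumr.
by apply: eq_bigr => q _; rewrite lie_gramC; rewrite /lie_gram; ring.
Qed.

(* The Gram operator is A |-> [[A, B], B^T], so its squared Hilbert-Schmidt norm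
   is the sum over the matrix units E of |[[E, B], B^T]|^2. *)
Lemma lie_gram_sqr_le (R : realFieldType) (n : nat) (B : 'M[R]_n) :
  \sum_p \sum_q lie_gram B p q ^+ 2 <= 4 * frob_dot B B * \sum_p lie_gram B p p.
Proof.
rewrite mulr_sumr; apply: ler_sum => p _.
have gramE q : lie_gram B p q = lie_mx (lie_mx (mx_unit R p) B) B^T q.1 q.2.
  by rewrite lie_gramC /lie_gram lie_mx_adjoint frob_dotC frob_dot_delta.
under eq_bigr do rewrite gramE.
by rewrite -(frob_dot_trmx B); exact: lie_mx_bound.
Qed.

(** Cauchy-Schwarz for the diagonal against the all-ones vector, then the off-diagonal squares are
    added. *)
Lemma sqr_mxtrace_le (R : realFieldType) (n : nat) (B : 'M[R]_n) :
  \tr B ^+ 2 <= n%:R * frob_dot B B.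
Proof.
rewrite /mxtrace.
have := sum_mul_sqr_le (fun _ : 'I_n => 1) (fun i => B i i).
under eq_bigr do rewrite mul1r.
under [X in _ <= X * _]eq_bigr do rewrite expr1n.
rewrite sumr_const card_ord => /le_trans; apply; apply: ler_wpM2l => //.
rewrite /frob_dot -(pair_bigA _ (fun i j => B i j * B i j))/=.
apply: ler_sum => i _; rewrite (bigD1 i)//= expr2 lerDl.
by apply: sumr_ge0 => j _; rewrite -expr2 sqr_ge0.
Qed.

(** * Borel measurability of matrix functions and of isometries *)

Lemma measurable_coord (R : realType) (n : nat) (i j : 'I_n) :
  measurable_fun setT (fun M : borel_mx R n => (M : 'M[R]_n) i j).
Proof.
apply: (measurability _ (RGenOpens.measurableE R)) => _ [_ [a [b ->]] <-].
rewrite setTI; apply: sub_sigma_algebra.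
by apply: open_comp => [M _|]; [exact: coord_continuous|exact: interval_open].
Qed.

Lemma coord_le_frob_norm (R : realType) (n : nat) (M : 'M[R]_n)
    (p : 'I_n * 'I_n) : `|M p.1 p.2| <= frob_norm M.
Proof.
rewrite frob_normE -sqrtr_sqr ler_wsqrtr// /frob_dot (bigD1 p)//= expr2 lerDl.
by apply: sumr_ge0 => q _; rewrite -expr2 sqr_ge0.
Qed.

(** The topology on matrices comes from the sup norm. With [coord_le_frob_norm], this comparison
    makes linear Frobenius isometries continuous, hence Borel. *)
Lemma frob_norm_le_mx_norm (R : realType) (n : nat) (M : 'M[R]_n) :
  frob_norm M <= #|{: 'I_n * 'I_n}|%:R * mx_norm M.
Proof.
have M0 : 0 <= mx_norm M by rewrite mx_normE.
rewrite -[leRHS]ger0_norm ?mulr_ge0// -sqrtr_sqr frob_normE ler_wsqrtr//.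
apply: (@le_trans _ _ (#|{: 'I_n * 'I_n}|%:R * mx_norm M ^+ 2)).
  rewrite mulr_natl -sumr_const; apply: ler_sum => p _.
  have Mp : `|M p.1 p.2| <= mx_norm M.
    by rewrite mx_normrE; exact: (le_bigmax _ (fun q => `|M q.1 q.2|) p).
  by rewrite -expr2 -(real_normK (num_real _)) ler_pXn2r ?nnegrE.
rewrite exprMn ler_wpM2r ?sqr_ge0// -natrX ler_nat.
by case: #|_| => // k; rewrite leq_pmulr.
Qed.

Lemma measurable_mx_isometry (R : realType) (n : nat)
    (Q : {linear 'M[R]_n -> 'M[R]_n}) :
  (forall M, frob_norm (Q M) = frob_norm M) ->
  measurable_fun setT (Q : borel_mx R n -> borel_mx R n).
Proof.
move=> Qiso.
have cQ : continuous (Q : 'M[R]_n -> 'M[R]_n).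
  apply: bounded_linear_continuous; apply/linear_boundedP.
  near=> r => M.
  have -> : `|Q M| = mx_norm (Q M) by [].
  have -> : `|M| = mx_norm M by [].
  have -> : mx_norm (Q M) <= r * mx_norm M = true.
    apply: (@le_trans _ _ (frob_norm (Q M))).
      (* A nonzero sup norm is attained at some entry [p]. *)
      have [->|/mx_norm_neq0[p ->]] := eqVneq (mx_norm (Q M)) 0.
        exact: sqrtr_ge0.
      exact: coord_le_frob_norm.
    rewrite Qiso (le_trans (frob_norm_le_mx_norm M))//.
    apply: ler_wpM2r; first by rewrite mx_normE.
    by near: r; exact: nbhs_pinfty_ge (num_real _).
  by [].
apply: (@measurability _ _ (borel_mx R n) (borel_mx R n) setT Q
  (@open 'M[R]_n)) => //.
move=> _ [U oU <-].
rewrite setTI; apply: sub_sigma_algebra.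
by apply: open_comp => // M _; exact: cQ.
Unshelve. all: by end_near. Qed.

Lemma measurable_frob_norm (R : realType) (n : nat) :
  measurable_fun setT (fun M : borel_mx R n => frob_norm M).
Proof.
rewrite /frob_norm; apply: measurableT_comp.
  apply: continuous_measurable_fun; exact: sqrt_continuous.
apply: measurable_sum => i; apply: measurable_sum => j.
by apply: measurable_funX; exact: measurable_coord.
Qed.

Lemma measurable_frob_sphere (R : realType) (n : nat) :
  measurable (@frob_sphere R n : set (borel_mx R n)).
Proof.
have := @measurable_frob_norm R n; move=> /(_ measurableT [set 1]).
by rewrite setTI; apply; exact: measurable_set1.
Qed.

(** * Means over the sphere and their invariance *)

(** A class stable under sums and products that contains the coordinates, so every polynomial in the
    entries belongs to it. *)
Definition sphere_bounded (R : realType) (n : nat) (f : borel_mx R n -> R) :=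
  measurable_fun setT f /\
  exists K, forall M, frob_sphere (M : 'M[R]_n) -> `|f M| <= K.

(* Restricting to the sphere, which has full measure, makes polynomials in the
   entries bounded, hence integrable. *)
Definition sphere_mean (R : realType) (n : nat)
    (mu : probability (borel_mx R n) R) (f : borel_mx R n -> R) : R :=
  \int[mu]_(M in (@frob_sphere R n : set (borel_mx R n))) f M.

Lemma sphere_bounded_cst (R : realType) (n : nat) (k : R) :
  sphere_bounded (fun _ : borel_mx R n => k).
Proof. by split=> //; exists `|k|. Qed.

Lemma sphere_boundedD (R : realType) (n : nat) (f g : borel_mx R n -> R) :
  sphere_bounded f -> sphere_bounded g -> sphere_bounded (fun M => f M + g M).
Proof.
move=> [mf [K fK]] [mg [L gL]]; split; first exact: measurable_funD.
exists (K + L) => M SM; apply: le_trans (ler_normD _ _) _.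
by rewrite lerD ?fK ?gL.
Qed.

Lemma sphere_boundedM (R : realType) (n : nat) (f g : borel_mx R n -> R) :
  sphere_bounded f -> sphere_bounded g -> sphere_bounded (fun M => f M * g M).
Proof.
move=> [mf [K fK]] [mg [L gL]]; split; first exact: measurable_funM.
by exists (K * L) => M SM; rewrite normrM ler_pM ?fK ?gL.
Qed.

Lemma sphere_bounded_sum (R : realType) (n : nat) (I : Type) (r : seq I)
    (f : I -> borel_mx R n -> R) :
  (forall i, sphere_bounded (f i)) ->
  sphere_bounded (fun M => \sum_(i <- r) f i M).
Proof.
move=> bf; elim: r => [|i r IH].
  by under eq_fun do rewrite big_nil; exact: sphere_bounded_cst.
by under eq_fun do rewrite big_cons; exact: sphere_boundedD.
Qed.

Lemma sphere_bounded_coord (R : realType) (n : nat) (p : 'I_n * 'I_n) :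
  sphere_bounded (fun M : borel_mx R n => (M : 'M[R]_n) p.1 p.2).
Proof.
split; first exact: measurable_coord.
by exists 1 => M SM; rewrite -[leRHS]SM; exact: coord_le_frob_norm.
Qed.

Lemma sphere_bounded_integrable (R : realType) (n : nat)
    (mu : probability (borel_mx R n) R) f : sphere_bounded f ->
  mu.-integrable (@frob_sphere R n : set (borel_mx R n)) (EFin \o f).
Proof.
move=> [mf [K fK]]; apply: measurable_bounded_integrable.
- exact: measurable_frob_sphere.
- rewrite (le_lt_trans (probability_le1 _ _)) ?ltry//.
  exact: measurable_frob_sphere.
- exact: measurable_funS mf.
- exists K; split; first exact: num_real.
  by move=> L KL M /fK /le_trans; apply; exact: ltW.
Qed.

Lemma sphere_meanD (R : realType) (n : nat) (mu : probability (borel_mx R n) R)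
    (f g : borel_mx R n -> R) : sphere_bounded f -> sphere_bounded g ->
  sphere_mean mu (fun M => f M + g M) = sphere_mean mu f + sphere_mean mu g.
Proof.
move=> bf bg; apply: RintegralD; first exact: measurable_frob_sphere.
- exact: sphere_bounded_integrable.
- exact: sphere_bounded_integrable.
Qed.

Lemma sphere_meanZ (R : realType) (n : nat) (mu : probability (borel_mx R n) R)
    (k : R) (f : borel_mx R n -> R) : sphere_bounded f ->
  sphere_mean mu (fun M => k * f M) = k * sphere_mean mu f.
Proof.
move=> bf; apply: RintegralZl; first exact: measurable_frob_sphere.
exact: sphere_bounded_integrable.
Qed.

Lemma sphere_mean_sum (R : realType) (n : nat)
    (mu : probability (borel_mx R n) R) (I : Type) (r : seq I)
    (f : I -> borel_mx R n -> R) :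
  (forall i, sphere_bounded (f i)) ->
  sphere_mean mu (fun M => \sum_(i <- r) f i M) =
  \sum_(i <- r) sphere_mean mu (f i).
Proof.
move=> bf; elim: r => [|i r IH].
  rewrite big_nil; under eq_fun do rewrite big_nil.
  by rewrite /sphere_mean Rintegral_cst ?mul0r//; exact: measurable_frob_sphere.
rewrite big_cons -IH; under eq_fun do rewrite big_cons.
by rewrite sphere_meanD//; exact: sphere_bounded_sum.
Qed.

Lemma sphere_mean_eq (R : realType) (n : nat)
    (mu : probability (borel_mx R n) R) (f g : borel_mx R n -> R) :
  (forall M, frob_sphere (M : 'M[R]_n) -> f M = g M) ->
  sphere_mean mu f = sphere_mean mu g.
Proof. by move=> fg; apply: eq_Rintegral => M; rewrite inE => /fg. Qed.

Lemma sphere_mean_ge0 (R : realType) (n : nat)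
    (mu : probability (borel_mx R n) R) (f : borel_mx R n -> R) :
  (forall M, frob_sphere (M : 'M[R]_n) -> 0 <= f M) -> 0 <= sphere_mean mu f.
Proof. by move=> f0; exact: Rintegral_ge0. Qed.

Lemma sphere_mean_cst (R : realType) (n : nat)
    (mu : probability (borel_mx R n) R) (k : R) :
  is_uniform_sphere mu -> sphere_mean mu (fun=> k) = k.
Proof.
move=> [mu1 _]; rewrite /sphere_mean Rintegral_cst; last first.
  exact: measurable_frob_sphere.
rewrite -[RHS]mulr1; congr (_ * _); exact: (congr1 fine mu1).
Qed.

(** Change of variables: [Q] pushes [mu] forward to itself, and the sphere is its own preimage under
    [Q]. *)
Lemma sphere_mean_isometry (R : realType) (n : nat)
    (mu : probability (borel_mx R n) R) (Q : {linear 'M[R]_n -> 'M[R]_n})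
    (f : borel_mx R n -> R) : is_uniform_sphere mu ->
  (forall M, frob_norm (Q M) = frob_norm M) -> sphere_bounded f ->
  sphere_mean mu (fun M => f (Q M)) = sphere_mean mu f.
Proof.
move=> [_ inv] Qiso bf; rewrite /sphere_mean /Rintegral; congr fine.
have mQ := measurable_mx_isometry Qiso.
pose S := @frob_sphere R n : set (borel_mx R n).
have QS : Q @^-1` S = S.
  by apply/seteqP; split=> M; rewrite /S /frob_sphere /= Qiso.
have mS : measurable S := @measurable_frob_sphere R n.
have bfQ : sphere_bounded (fun M : borel_mx R n => f (Q M)).
  case: bf => mf [K fK]; split; first exact: measurableT_comp mf mQ.
  by exists K => M; rewrite -[frob_sphere _]/(S M) -QS => /fK.
rewrite -/S.
pose Qm : {mfun borel_mx R n >-> borel_mx R n} :=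
  HB.pack (Q : borel_mx R n -> borel_mx R n)
    (isMeasurableFun.Build _ _ _ _ _ mQ).
have := @integral_pushforward _ _ _ _ R Qm mQ mu S (EFin \o f).
rewrite [Qm @^-1` S]QS => <-//; last 2 first.
- apply/measurable_EFinP; exact: bf.1.
- exact: sphere_bounded_integrable.
by apply: eq_measure_integral => E mE _; exact: inv.
Qed.

(** * Householder reflections and the moments of order four and two *)

(** The Householder reflection along [U] when t |U|^2 = 2. Keeping [t] free avoids division and
    gives a linear map for every [t] and [U]. *)
Definition mx_reflection (R : comPzRingType) (n : nat) (t : R)
    (U M : 'M[R]_n) : 'M[R]_n :=
  M - (t * frob_dot U M) *: U.

Lemma mx_reflection_is_linear (R : comPzRingType) (n : nat) (t : R)
    (U : 'M[R]_n) :
  linear (mx_reflection t U).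
Proof.
move=> a M N; rewrite /mx_reflection frob_dotDr frob_dotZr.
apply/matrixP => i j; rewrite !mxE; ring.
Qed.

HB.instance Definition _ (R : comPzRingType) (n : nat) (t : R) (U : 'M[R]_n) :=
  GRing.isLinear.Build R 'M[R]_n 'M[R]_n *:%R (mx_reflection t U)
    (mx_reflection_is_linear t U).

Lemma frob_norm_reflection (R : realType) (n : nat) (t : R) (U M : 'M[R]_n) :
  t * frob_dot U U = 2 -> frob_norm (mx_reflection t U M) = frob_norm M.
Proof.
move=> tU; rewrite !frob_normE; congr Num.sqrt.
have sq c : frob_dot (M - c *: U) (M - c *: U) =
    frob_dot M M - 2 * c * frob_dot U M + c ^+ 2 * frob_dot U U.
  rewrite /frob_dot !mulr_sumr -sumrB -big_split/=.
  by apply: eq_bigr => p _; rewrite !mxE; ring.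
rewrite /mx_reflection sq -[RHS]addr0 -addrA; congr (_ + _).
(* The change in |M|^2 contains the factor t |U|^2 - 2, which is zero by [tU]. *)
transitivity (t * frob_dot U M ^+ 2 * (t * frob_dot U U - 2)); first by ring.
by rewrite tU subrr mulr0.
Qed.

Definition mx_coord (R : realType) (n : nat) (p : 'I_n * 'I_n)
  (M : borel_mx R n) : R := (M : 'M[R]_n) p.1 p.2.

Ltac sphere_bnd := repeat first
  [ exact: sphere_bounded_coord | exact: sphere_bounded_cst
  | apply: sphere_boundedM | apply: sphere_boundedD
  | apply: sphere_bounded_sum => ? ].

Definition moment4 (R : realType) (n : nat) (mu : probability (borel_mx R n) R)
    (p q r s : 'I_n * 'I_n) : R :=
  sphere_mean mu (fun M =>
    mx_coord p M * mx_coord q M * (mx_coord r M * mx_coord s M)).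

(* Reflect in the hyperplane orthogonal to the coordinate b. *)
Lemma moment4_odd (R : realType) (n : nat) (mu : probability (borel_mx R n) R)
    (b p q r s : 'I_n * 'I_n) : is_uniform_sphere mu ->
  (p == b) (+) (q == b) (+) (r == b) (+) (s == b) -> moment4 mu p q r s = 0.
Proof.
move=> umu odd_b.
have tU : 2 * frob_dot (mx_unit R b) (mx_unit R b) = 2.
  by rewrite frob_dot_delta mxE !eqxx mulr1.
have coordQ c (M : borel_mx R n) :
    mx_coord c (mx_reflection 2 (mx_unit R b) M) =
    (-1) ^+ (c == b) * mx_coord c M.
  rewrite /mx_coord /mx_reflection frob_dotC frob_dot_delta !mxE.
  rewrite -xpair_eqE -!surjective_pairing.
  by case: eqP => [->|_] /=; ring.
have bf : sphere_bounded (fun M : borel_mx R n =>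
    mx_coord p M * mx_coord q M * (mx_coord r M * mx_coord s M)).
  by sphere_bnd.
have := sphere_mean_isometry umu (fun M => frob_norm_reflection M tU) bf.
have -> : (fun M => mx_coord p (mx_reflection 2 (mx_unit R b) M) *
    mx_coord q (mx_reflection 2 (mx_unit R b) M) *
    (mx_coord r (mx_reflection 2 (mx_unit R b) M) *
     mx_coord s (mx_reflection 2 (mx_unit R b) M))) =
  (fun M : borel_mx R n =>
    -1 * (mx_coord p M * mx_coord q M * (mx_coord r M * mx_coord s M))).
  apply/funext => M; rewrite !coordQ.
  move: odd_b.
  by case: (p == b); case: (q == b); case: (r == b); case: (s == b) => //= _;
    ring.
rewrite sphere_meanZ// -/(moment4 _ _ _ _ _); lra.
Qed.

(* Reflect in the hyperplane orthogonal to e_a + 2 e_b: this maps x_a to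
   (3 x_a - 4 x_b) / 5, a rational substitute for the rotation by 45 degrees. *)
Lemma moment4_diag (R : realType) (n : nat) (mu : probability (borel_mx R n) R)
    (a b : 'I_n * 'I_n) : is_uniform_sphere mu -> a != b ->
  moment4 mu a a a a * 625 =
  moment4 mu a a a a * 81 + moment4 mu a a b b * 864 + moment4 mu b b b b * 256.
Proof.
move=> umu ab.
pose U : 'M[R]_n := mx_unit R a + 2 *: mx_unit R b.
have dotU M : frob_dot U M = M a.1 a.2 + 2 * M b.1 b.2.
  by rewrite frob_dotC frob_dotDr frob_dotZr !frob_dot_delta.
have [Ua Ub] : U a.1 a.2 = 1 /\ U b.1 b.2 = 2.
  rewrite !mxE -!xpair_eqE -!surjective_pairing !eqxx [b == a]eq_sym.
  rewrite (negbTE ab).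
  by rewrite mulr0 mulr1 addr0 add0r.
have tU : 2 / 5 * frob_dot U U = 2 by rewrite dotU Ua Ub; field.
have coordQ (M : borel_mx R n) : mx_coord a (mx_reflection (2 / 5) U M) =
    3 / 5 * mx_coord a M - 4 / 5 * mx_coord b M.
  by rewrite {1}/mx_coord /mx_reflection dotU 3!mxE Ua /mx_coord; field.
have bf : sphere_bounded (fun M : borel_mx R n =>
    mx_coord a M * mx_coord a M * (mx_coord a M * mx_coord a M)).
  by sphere_bnd.
have := sphere_mean_isometry umu (fun M => frob_norm_reflection M tU) bf.
(* Binomial expansion of (3 x_a - 4 x_b)^4 / 5^4; the two terms with odd exponents then vanish by
   [moment4_odd]. *)
have -> : (fun M => mx_coord a (mx_reflection (2 / 5) U M) *
    mx_coord a (mx_reflection (2 / 5) U M) *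
    (mx_coord a (mx_reflection (2 / 5) U M) *
     mx_coord a (mx_reflection (2 / 5) U M))) =
  (fun M : borel_mx R n =>
     81 / 625 * (mx_coord a M * mx_coord a M * (mx_coord a M * mx_coord a M)) +
     - (432 / 625) *
       (mx_coord a M * mx_coord a M * (mx_coord a M * mx_coord b M)) +
     864 / 625 * (mx_coord a M * mx_coord a M * (mx_coord b M * mx_coord b M)) +
     - (768 / 625) *
       (mx_coord a M * mx_coord b M * (mx_coord b M * mx_coord b M)) +
     256 / 625 * (mx_coord b M * mx_coord b M * (mx_coord b M * mx_coord b M))).
  by apply/funext => M; rewrite !coordQ; field.
do 4! (rewrite sphere_meanD; [|by sphere_bnd..]).
do 5! (rewrite sphere_meanZ; [|by sphere_bnd]).
rewrite -!/(moment4 _ _ _ _ _).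
have -> : moment4 mu a a a b = 0.
  apply: (@moment4_odd _ _ _ a) => //.
  by rewrite !eqxx [b == a]eq_sym (negbTE ab).
have -> : moment4 mu a b b b = 0.
  apply: (@moment4_odd _ _ _ a) => //.
  by rewrite !eqxx [b == a]eq_sym (negbTE ab).
lra.
Qed.

(** These three permutations generate the symmetric group on the four indices. *)
Lemma moment4_perm (R : realType) (n : nat) (mu : probability (borel_mx R n) R)
    (p q r s : 'I_n * 'I_n) :
  (moment4 mu p q r s = moment4 mu q p r s) *
  (moment4 mu p q r s = moment4 mu p r q s) *
  (moment4 mu p q r s = moment4 mu r s p q).
Proof.
by split; first split; congr sphere_mean; apply/funext => M; ring.
Qed.

(** Apply [moment4_diag] to (a, b) and to (b, a): the difference of the two linear equations equates
    the pure moments, and either one then gives the mixed moment. *)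
Lemma moment4_pair (R : realType) (n : nat) (mu : probability (borel_mx R n) R)
    (a b : 'I_n * 'I_n) : is_uniform_sphere mu -> a != b ->
  moment4 mu a a a a = moment4 mu b b b b /\
  moment4 mu a a b b = moment4 mu b b b b / 3.
Proof.
move=> umu ab; have := moment4_diag umu ab.
rewrite eq_sym in ab; have := moment4_diag umu ab.
have -> : moment4 mu a a b b = moment4 mu b b a a.
  by rewrite (moment4_perm mu a a b b).2.
by move=> h1 h2; split; lra.
Qed.

(** Case analysis on coincidences. Either some index occurs an odd number of times and [moment4_odd]
    applies, or the indices pair up. The factor in front is m of the overview, for an arbitrary
    reference coordinate [a]. *)
Lemma moment4E (R : realType) (n : nat) (mu : probability (borel_mx R n) R)
    (a : 'I_n * 'I_n) (p q r s : 'I_n * 'I_n) : is_uniform_sphere mu ->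
  moment4 mu p q r s = moment4 mu a a a a / 3 *
    ((p == q)%:R * (r == s)%:R + (p == r)%:R * (q == s)%:R
     + (p == s)%:R * (q == r)%:R).
Proof.
move=> umu.
have m4 b : moment4 mu b b b b = moment4 mu a a a a.
  by have [->//|ba] := eqVneq b a; have [] := moment4_pair umu ba.
have m22 b c : b != c -> moment4 mu b b c c = moment4 mu a a a a / 3.
  by move=> bc; have [_ ->] := moment4_pair umu bc; rewrite m4.
have odd0 b : (p == b) (+) (q == b) (+) (r == b) (+) (s == b) ->
    moment4 mu p q r s = 0 by exact: moment4_odd.
have neqF (b c : 'I_n * 'I_n) :
    b != c -> ((b == c) = false) * ((c == b) = false).
  by move=> /negbTE bc; rewrite [c == b]eq_sym.
have [pq|/neqF pq] := eqVneq p q; [subst q|have [pr|/neqF pr] := eqVneq p r].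
- have [rs|/neqF rs] := eqVneq r s; [subst s|].
    have [<-|pr] := eqVneq p r; first by rewrite m4 /=; field.
    by rewrite m22//=; ring.
  have [pr|/neqF pr] := eqVneq p r; [subst r|].
    by rewrite (odd0 s) ?eqxx ?rs//=; ring.
  by rewrite (odd0 r) ?eqxx ?rs ?pr//=; ring.
- subst r; have [qs|/neqF qs] := eqVneq q s; [subst s|].
    have -> : moment4 mu p q p q = moment4 mu p p q q.
      by rewrite (moment4_perm mu p q p q).1.2.
    by rewrite m22 ?pq//= ?pq; ring.
  by rewrite (odd0 q) ?eqxx ?qs ?pq//=; ring.
- have [ps|/neqF ps] := eqVneq p s; [subst s|].
    have [qr|/neqF qr] := eqVneq q r; [subst r|].
      have -> : moment4 mu p q q p = moment4 mu p p q q.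
        rewrite (moment4_perm mu p q q p).1.1 (moment4_perm mu q p q p).1.2.
        by rewrite (moment4_perm mu q q p p).2.
      by rewrite m22 ?pq//=; ring.
    by rewrite (odd0 q) ?eqxx ?qr ?pq//=; ring.
  by rewrite (odd0 p) ?eqxx ?ps ?pr ?pq//=; ring.
Qed.

Lemma sum_kronecker (R : pzRingType) (I : finType) (i : I) (F : I -> R) :
  \sum_j (i == j)%:R * F j = F i.
Proof.
rewrite (bigD1 i)//= eqxx mul1r big1 ?addr0// => j ji.
by rewrite eq_sym (negbTE ji) mul0r.
Qed.

Lemma sphere_sum_sqr (R : realType) (n : nat) (M : borel_mx R n) :
  frob_sphere (M : 'M[R]_n) -> \sum_p mx_coord p M * mx_coord p M = 1.
Proof.
move=> SM; rewrite -[LHS]/(frob_dot _ _) -sqr_frob_norm.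
by rewrite [frob_norm _]SM expr1n.
Qed.

Lemma moment4_sum_sqr (R : realType) (n : nat)
    (mu : probability (borel_mx R n) R) (p q : 'I_n * 'I_n) :
  \sum_r moment4 mu p q r r =
  sphere_mean mu (fun M => mx_coord p M * mx_coord q M).
Proof.
rewrite /moment4 -(sphere_mean_sum mu); last by move=> r; sphere_bnd.
apply: sphere_mean_eq => M SM.
by rewrite -mulr_sumr sphere_sum_sqr// mulr1.
Qed.

(** Contract the moment tensor twice: the constraint sum x_p^2 = 1 gives 1, the pairing formula
    gives m N (N + 2). *)
Lemma moment4_total (R : realType) (n : nat)
    (mu : probability (borel_mx R n) R) (a : 'I_n * 'I_n) :
  is_uniform_sphere mu ->
  moment4 mu a a a a / 3 * (n ^ 2)%:R * ((n ^ 2)%:R + 2) = 1.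
Proof.
move=> umu; have card2 : #|{: 'I_n * 'I_n}| = (n ^ 2)%N.
  by rewrite card_prod card_ord mulnn.
transitivity (\sum_p \sum_q moment4 mu p p q q); last first.
  transitivity (sphere_mean mu (fun=> 1)); last exact: sphere_mean_cst.
  under eq_bigr do rewrite moment4_sum_sqr.
  rewrite -(sphere_mean_sum mu); last by move=> r; sphere_bnd.
  by apply: sphere_mean_eq => M; exact: sphere_sum_sqr.
have m4 p q : moment4 mu p p q q = moment4 mu a a a a / 3
    + 2 * (moment4 mu a a a a / 3) * ((p == q)%:R * (p == q)%:R).
  by rewrite (moment4E a)// !eqxx/=; ring.
have inner p : \sum_q moment4 mu p p q q =
    moment4 mu a a a a / 3 * ((n ^ 2)%:R + 2).
  under eq_bigr do rewrite m4.
  rewrite big_split/= sumr_const card2 -mulr_sumr sum_kronecker eqxx/=.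
  by rewrite -mulr_natr; ring.
under eq_bigr do rewrite inner.
rewrite sumr_const card2 -mulr_natr; ring.
Qed.

(** Contracting the fourth moments once gives m (N + 2) on the diagonal, which is 1 / N by
    [moment4_total]. *)
Lemma moment2E (R : realType) (n : nat) (mu : probability (borel_mx R n) R)
    (p q : 'I_n * 'I_n) : is_uniform_sphere mu ->
  sphere_mean mu (fun M => mx_coord p M * mx_coord q M) =
  (p == q)%:R / (n ^ 2)%:R.
Proof.
move=> umu; have := moment4_total p umu.
rewrite -moment4_sum_sqr.
have m4 r : moment4 mu p q r r = (p == q)%:R * (moment4 mu p p p p / 3)
    + 2 * (moment4 mu p p p p / 3) * ((p == r)%:R * (q == r)%:R).
  by rewrite (moment4E p)// !eqxx/=; ring.
under eq_bigr do rewrite m4.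
have card2 : #|{: 'I_n * 'I_n}| = (n ^ 2)%N.
  by rewrite card_prod card_ord mulnn.
rewrite big_split/= sumr_const card2 -mulr_sumr sum_kronecker.
rewrite [q == p]eq_sym.
set m := moment4 mu p p p p / 3.
set N := (n ^ 2)%:R; set e := (p == q)%:R => mN.
have N0 : N != 0.
  apply/eqP => N0; move: mN; rewrite N0 mulr0 mul0r => /esym/eqP.
  by rewrite oner_eq0.
have -> : N^-1 = m * (N + 2).
  by apply: (mulfI N0); rewrite divff// mulrA [N * m]mulrC mN.
by rewrite -[e * m *+ _]mulr_natr -/N; ring.
Qed.

(** * Mean and mean square deviation of quadratic forms on the sphere *)

Definition quad_form (R : realType) (n : nat)
    (S : 'I_n * 'I_n -> 'I_n * 'I_n -> R) (M : borel_mx R n) : R :=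
  \sum_p \sum_q S p q * (mx_coord p M * mx_coord q M).

Lemma quad_form_mean (R : realType) (n : nat)
    (mu : probability (borel_mx R n) R) (S : 'I_n * 'I_n -> 'I_n * 'I_n -> R) :
  is_uniform_sphere mu ->
  sphere_mean mu (quad_form S) = (\sum_p S p p) / (n ^ 2)%:R.
Proof.
move=> umu.
rewrite sphere_mean_sum; last by move=> p; sphere_bnd.
rewrite mulr_suml; apply: eq_bigr => p _.
rewrite sphere_mean_sum; last by move=> q; sphere_bnd.
rewrite -(sum_kronecker p (fun q => S p q / (n ^ 2)%:R)).
apply: eq_bigr => q _; rewrite sphere_meanZ; last by sphere_bnd.
by rewrite moment2E//; ring.
Qed.

(** One contraction of the moment tensor with S; a second one yields the mean square in
    [quad_form_mean_sqr]. *)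
Lemma quad_form_mean_coord (R : realType) (n : nat)
    (mu : probability (borel_mx R n) R) (S : 'I_n * 'I_n -> 'I_n * 'I_n -> R)
    (a p q : 'I_n * 'I_n) :
  is_uniform_sphere mu -> (forall p q, S p q = S q p) ->
  sphere_mean mu (fun M => mx_coord p M * mx_coord q M * quad_form S M) =
  moment4 mu a a a a / 3 * ((p == q)%:R * \sum_r S r r + 2 * S p q).
Proof.
move=> umu S_sym.
transitivity (\sum_r \sum_s S r s * moment4 mu p q r s).
  rewrite /quad_form; under eq_fun do rewrite mulr_sumr.
  rewrite sphere_mean_sum; last by move=> r; sphere_bnd.
  apply: eq_bigr => r _; under eq_fun do rewrite mulr_sumr.
  rewrite sphere_mean_sum; last by move=> s; sphere_bnd.
  apply: eq_bigr => s _; rewrite -sphere_meanZ; last by sphere_bnd.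
  by congr sphere_mean; apply/funext => M; ring.
have -> : 2 * S p q = S p q + S q p by rewrite (S_sym q p); ring.
transitivity (moment4 mu a a a a / 3 * (\sum_r ((p == q)%:R * S r r
    + (p == r)%:R * S r q + (q == r)%:R * S r p))); last first.
  by rewrite !big_split/= -mulr_sumr !sum_kronecker addrA.
rewrite mulr_sumr; apply: eq_bigr => r _.
(* Each of the three terms becomes a Kronecker sum over [s], to be matched with one pairing in
   [moment4E]. *)
rewrite -(sum_kronecker r (fun s => (p == q)%:R * S r s)).
rewrite -(sum_kronecker q (fun s => (p == r)%:R * S r s)).
rewrite -(sum_kronecker p (fun s => (q == r)%:R * S r s)).
rewrite -!big_split/= mulr_sumr; apply: eq_bigr => s _.
by rewrite (moment4E a)//; ring.
Qed.

Lemma quad_form_mean_sqr (R : realType) (n : nat)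
    (mu : probability (borel_mx R n) R) (S : 'I_n * 'I_n -> 'I_n * 'I_n -> R)
    (a : 'I_n * 'I_n) :
  is_uniform_sphere mu -> (forall p q, S p q = S q p) ->
  sphere_mean mu (fun M => quad_form S M * quad_form S M) =
  moment4 mu a a a a / 3 *
    ((\sum_r S r r) ^+ 2 + 2 * \sum_p \sum_q S p q ^+ 2).
Proof.
move=> umu S_sym.
transitivity (\sum_p \sum_q S p q *
    sphere_mean mu (fun M => mx_coord p M * mx_coord q M * quad_form S M)).
  under eq_fun => M do rewrite [X in X * _]/quad_form mulr_suml.
  rewrite sphere_mean_sum; last by move=> p; sphere_bnd.
  apply: eq_bigr => p _; under eq_fun do rewrite mulr_suml.
  rewrite sphere_mean_sum; last by move=> q; sphere_bnd.
  apply: eq_bigr => q _; rewrite -sphere_meanZ; last by sphere_bnd.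
  by congr sphere_mean; apply/funext => M; ring.
rewrite expr2 mulr_suml mulr_sumr -big_split mulr_sumr/=.
apply: eq_bigr => p _.
rewrite -(sum_kronecker p (fun q => S p q * \sum_r S r r)) mulr_sumr.
rewrite -big_split/=.
rewrite mulr_sumr; apply: eq_bigr => q _.
by rewrite (quad_form_mean_coord a)//; ring.
Qed.

(** Squared bias plus a variance bound. The centre [c] is free because it will be 2/n, whereas the
    true mean depends on tr B. *)
Lemma quad_form_mean_sqr_dist_le (R : realType) (n : nat)
    (mu : probability (borel_mx R n) R) (S : 'I_n * 'I_n -> 'I_n * 'I_n -> R)
    (c : R) :
  (0 < n)%N -> is_uniform_sphere mu -> (forall p q, S p q = S q p) ->
  sphere_mean mu (fun M => (quad_form S M - c) ^+ 2) <=
  ((\sum_p S p p) / (n ^ 2)%:R - c) ^+ 2 +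
  2 * (\sum_p \sum_q S p q ^+ 2) / (n ^ 2)%:R ^+ 2.
Proof.
move=> n0 umu S_sym; pose a := (Ordinal n0, Ordinal n0).
under eq_fun => M.
  rewrite (_ : _ ^+ 2 = quad_form S M * quad_form S M
    + (- 2 * c) * quad_form S M + c ^+ 2); last by ring.
  over.
have bq : sphere_bounded (quad_form S) by rewrite /quad_form; sphere_bnd.
rewrite sphere_meanD; [|by repeat first [exact: bq|sphere_bnd]..].
rewrite sphere_meanD; [|by repeat first [exact: bq|sphere_bnd]..].
rewrite sphere_meanZ// sphere_mean_cst// quad_form_mean//.
rewrite (quad_form_mean_sqr a)//.
have := moment4_total a umu; have m0 : 0 <= moment4 mu a a a a / 3.
  apply: divr_ge0 => //; apply: sphere_mean_ge0 => M _.
  by rewrite -expr2 sqr_ge0.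
move: m0; set m := moment4 mu a a a a / 3; set N := (n ^ 2)%:R.
set t := \sum_p S p p; set s := \sum_p _ => m0 mN.
have N0 : 0 < N by rewrite ltr0n expn_gt0 n0.
have s0 : 0 <= s.
  by apply: sumr_ge0 => p _; apply: sumr_ge0 => q _; exact: sqr_ge0.
(* From m N (N + 2) = 1 by dropping the 2; with this bound on m the square can be completed
   exactly. *)
have mN2 : m <= (N ^+ 2)^-1.
  rewrite -[leRHS]mul1r ler_pdivlMr ?exprn_gt0// -[leRHS]mN.
  by have := mulr_ge0 m0 (ltW N0); lra.
have : m * (t ^+ 2 + 2 * s) <= (N ^+ 2)^-1 * (t ^+ 2 + 2 * s).
  by apply: ler_wpM2r => //; rewrite addr_ge0 ?sqr_ge0// mulr_ge0.
have -> : (t / N - c) ^+ 2 + 2 * s / N ^+ 2 =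
  (N ^+ 2)^-1 * (t ^+ 2 + 2 * s) + - 2 * c * (t / N) + c ^+ 2.
  by field; rewrite pnatr_eq0 -lt0n.
by move=> h; rewrite !lerD2r.
Qed.

Lemma lie_mx_mean_sqr_dist_le (R : realType) (n : nat)
    (mu : probability (borel_mx R n) R) (B : 'M[R]_n) :
  (0 < n)%N -> is_uniform_sphere mu -> frob_sphere B ->
  sphere_mean mu (fun M : borel_mx R n =>
    (frob_dot (lie_mx (M : 'M[R]_n) B) (lie_mx (M : 'M[R]_n) B)
     - 2 / n%:R) ^+ 2) <=
  (4 * \tr B ^+ 2 + 16) / n%:R ^+ 3.
Proof.
move=> n0 umu SB.
have BB : frob_dot B B = 1 by rewrite -sqr_frob_norm [frob_norm B]SB expr1n.
under eq_fun do rewrite lie_mx_quadratic.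
apply: le_trans (quad_form_mean_sqr_dist_le _ n0 umu (lie_gramC B)) _.
have := lie_gram_sqr_le B; have := lie_mx_trace B; have := sqr_mxtrace_le B.
rewrite -/(lie_gram B _ _) BB !mulr1.
have -> : \sum_p frob_dot (lie_mx (mx_unit R p) B) (lie_mx (mx_unit R p) B) =
   \sum_p lie_gram B p p by [].
set t := \tr B ^+ 2; set s := \sum_p \sum_q _ ^+ 2.
set T := \sum_p lie_gram B p p.
rewrite natrX => tn -> sT.
have x0 : 0 < n%:R :> R by rewrite ltr0n.
have xn0 := lt0r_neq0 x0.
have t0 : 0 <= t by rewrite sqr_ge0.
move: x0 xn0 tn sT; set x := n%:R => x0 xn0 tn sT.
(* The bias is -2 t / n^2. Its square is controlled by t <= n, and 2 s <= 8 (2 n - 2 t) <= 16 n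
   controls the other term. *)
have -> : ((x *+ 2 - t *+ 2) / x ^+ 2 - 2 / x) ^+ 2 + 2 * s / (x ^+ 2) ^+ 2 =
  (4 * t * t + 2 * s) / x ^+ 4 by field.
have -> : (4 * t + 16) / x ^+ 3 = (4 * t * x + 16 * x) / x ^+ 4.
  by field.
rewrite ler_pM2r ?invr_gt0 ?exprn_gt0//; nra.
Qed.

(** * Deviation probability for one commutator *)

Lemma EFin_sphere_mean (R : realType) (n : nat)
    (mu : probability (borel_mx R n) R) (f : borel_mx R n -> R) :
  sphere_bounded f ->
  (\int[mu]_(M in (@frob_sphere R n : set (borel_mx R n))) (f M)%:E)%E =
  (sphere_mean mu f)%:E.
Proof.
move=> bf; rewrite /sphere_mean /Rintegral fineK//.
apply: integrable_fin_num; last exact: sphere_bounded_integrable.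
exact: measurable_frob_sphere.
Qed.

Lemma sphere_compl_measure0 (R : realType) (n : nat)
    (mu : probability (borel_mx R n) R) : is_uniform_sphere mu ->
  mu (~` (@frob_sphere R n : set (borel_mx R n))) = 0%E.
Proof.
move=> [mu1 _]; rewrite probability_setC; last exact: measurable_frob_sphere.
by apply/eqP; rewrite sube_eq ?add0e//; apply/eqP/esym.
Qed.

Lemma sphere_markov (R : realType) (n : nat)
    (mu : probability (borel_mx R n) R) (f : borel_mx R n -> R) (a : R) :
  is_uniform_sphere mu -> sphere_bounded f -> (forall M, 0 <= f M) -> 0 < a ->
  (mu [set M | (a <= f M)%R] <= (sphere_mean mu f / a)%:E)%E.
Proof.
move=> umu bf f0 a0.
pose S := @frob_sphere R n : set (borel_mx R n).
have mS : measurable S := @measurable_frob_sphere R n.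
have mE : measurable [set M | a <= f M].
  rewrite -[X in measurable X]setTI.
  by apply: measurable_fun_le => //; exact: bf.1.
(* The complement of the sphere is null, so Markov's inequality on the sphere bounds the full
   event. *)
have muE : mu [set M | a <= f M] = mu (S `&` [set M | a <= f M]).
  apply/eqP; rewrite eq_le; apply/andP; split; last first.
    by apply: le_measure; rewrite ?inE//; exact: measurableI.
  apply: (@le_trans _ _ (mu ((S `&` [set M | a <= f M]) `|` ~` S))).
    apply: le_measure; rewrite ?inE//.
      by apply: measurableU; [exact: measurableI|exact: measurableC].
    by move=> M Ma; have [SM|SM] := pselect (S M); [left|right].
  apply: le_trans (measureU2 _ _ _) _; [exact: measurableI|exact: measurableC|].
  by rewrite [X in (_ + X <= _)%E]sphere_compl_measure0// adde0.
have := @le_integral_abse _ _ R mu S mS (EFin \o f) a.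
have mf : measurable_fun S (EFin \o f).
  by apply/measurable_EFinP; apply: measurable_funS bf.1.
move=> /(_ mf a0).
rewrite (_ : [set _ | _] = [set M | a <= f M]); last first.
  by apply/seteqP; split=> M /=; rewrite lee_fin ger0_norm.
under eq_integral do rewrite /= ger0_norm//.
rewrite EFin_sphere_mean// muE.
(* Division by [a] in the extended reals; the finite bound rules out an infinite [v]. *)
have key (v : \bar R) (m : R) :
    (0 <= v -> a%:E * v <= m%:E -> v <= (m / a)%:E)%E.
  case: v => [v| |] // _; first by rewrite -EFinM !lee_fin ler_pdivlMr// mulrC.
  by rewrite gt0_muley.
exact: key.
Qed.

(* comm_dev A B >= 1 / (4 n^2) says that n |AB - BA|^2 is at distance at least
   1/2 from 2. *)
Definition comm_dev (R : realType) (n : nat) (A B : borel_mx R n) : R :=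
  (frob_dot (lie_mx (A : 'M[R]_n) B) (lie_mx (A : 'M[R]_n) B) - 2 / n%:R) ^+ 2.

Lemma measurable_lie_mx_dot (R : realType) (n : nat) d (T : measurableType d)
    (X Y : T -> borel_mx R n) :
  measurable_fun setT X -> measurable_fun setT Y ->
  measurable_fun setT (fun w =>
    frob_dot (lie_mx (X w : 'M[R]_n) (Y w)) (lie_mx (X w : 'M[R]_n) (Y w))).
Proof.
move=> mX mY.
have mc Z p : measurable_fun setT (Z : T -> borel_mx R n) ->
    measurable_fun setT (fun w => mx_coord p (Z w)).
  by move=> mZ; apply: measurableT_comp mZ; exact: measurable_coord.
have ml p : measurable_fun setT
    (fun w => lie_mx (X w : 'M[R]_n) (Y w) p.1 p.2).
  under eq_fun do rewrite 4!mxE.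
  apply: measurable_funB; apply: measurable_sum => k.
    by apply: measurable_funM; [exact: (mc X (p.1, k))|exact: (mc Y (k, p.2))].
  by apply: measurable_funM; [exact: (mc Y (p.1, k))|exact: (mc X (k, p.2))].
by apply: measurable_sum => p; exact: measurable_funM.
Qed.

Lemma measurable_comm_dev (R : realType) (n : nat) d (T : measurableType d)
    (X Y : T -> borel_mx R n) :
  measurable_fun setT X -> measurable_fun setT Y ->
  measurable_fun setT (fun w => comm_dev (X w) (Y w)).
Proof.
move=> mX mY; apply: measurable_funX; apply: measurable_funB => //.
exact: measurable_lie_mx_dot.
Qed.

Lemma comm_dev_bounded (R : realType) (n : nat) (B : borel_mx R n) :
  sphere_bounded (fun A => comm_dev A B).
Proof.
rewrite /comm_dev; under eq_fun do rewrite lie_mx_quadratic expr2.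
by repeat first [sphere_bnd | exact: sphere_bounded_coord].
Qed.

(** Chebyshev for fixed [B]: the mean square bound (4 (tr B)^2 + 16) / n^3 is multiplied by 4
    n^2. *)
Lemma comm_dev_fiber (R : realType) (n : nat)
    (mu : probability (borel_mx R n) R) (B : borel_mx R n) :
  (0 < n)%N -> is_uniform_sphere mu -> frob_sphere (B : 'M[R]_n) ->
  (mu [set A | (1 / (4 * n%:R ^+ 2) <= comm_dev A B)%R] <=
  (64 / n%:R + 16 / n%:R * \tr (B : 'M[R]_n) ^+ 2)%:E)%E.
Proof.
move=> n0 umu SB.
have x0 : 0 < n%:R :> R by rewrite ltr0n.
apply: le_trans (sphere_markov umu (comm_dev_bounded B) _ _) _.
- by move=> A; exact: sqr_ge0.
- by rewrite divr_gt0// mulr_gt0// exprn_gt0.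
have := lie_mx_mean_sqr_dist_le n0 umu SB.
rewrite lee_fin -/(comm_dev _ _) => h.
rewrite ler_pdivrMr ?divr_gt0// ?mulr_gt0// ?exprn_gt0//.
apply: le_trans h _; rewrite le_eqVlt; apply/predU1l.
by field; rewrite pnatr_eq0 -lt0n.
Qed.

Lemma sphere_bounded_sqr_trace (R : realType) (n : nat) :
  sphere_bounded (fun B : borel_mx R n => \tr (B : 'M[R]_n) ^+ 2).
Proof.
rewrite (_ : (fun _ => _) = fun B =>
  (\sum_i mx_coord (i, i) B) * (\sum_i mx_coord (i, i) B)); first by sphere_bnd.
by apply/funext => B; rewrite -expr2.
Qed.

Lemma sphere_mean_sqr_trace (R : realType) (n : nat)
    (mu : probability (borel_mx R n) R) : (0 < n)%N -> is_uniform_sphere mu ->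
  sphere_mean mu (fun B => \tr (B : 'M[R]_n) ^+ 2) = n%:R^-1.
Proof.
move=> n0 umu.
have -> : (fun B : borel_mx R n => \tr (B : 'M[R]_n) ^+ 2) =
  (fun B => \sum_i \sum_j mx_coord (i, i) B * mx_coord (j, j) B).
  by apply/funext => B; rewrite expr2 big_distrlr.
rewrite sphere_mean_sum; last by move=> i; sphere_bnd.
transitivity (\sum_(i < n) \sum_(j < n) (i == j)%:R * (n ^ 2)%:R^-1 : R).
  apply: eq_bigr => i _; rewrite sphere_mean_sum; last by move=> j; sphere_bnd.
  by apply: eq_bigr => j _; rewrite moment2E// xpair_eqE andbb.
under eq_bigr do rewrite sum_kronecker.
rewrite sumr_const card_ord -mulr_natl natrX; field.
by rewrite pnatr_eq0 -lt0n.
Qed.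

(** Independence makes the joint law a product, so the fibre bound can be integrated over the law of
    [Y]. With E (tr B)^2 = 1/n this gives 64/n + 16/n^2 <= 80/n. *)
Lemma comm_dev_probability_le (R : realType) (n : nat) d (T : measurableType d)
    (P : probability T R) (X Y : {RV P >-> borel_mx R n}) :
  (0 < n)%N ->
  is_uniform_sphere (distribution P X) ->
  is_uniform_sphere (distribution P Y) ->
  (forall E F : set (borel_mx R n), measurable E -> measurable F ->
    P (X @^-1` E `&` Y @^-1` F) = (P (X @^-1` E) * P (Y @^-1` F))%E) ->
  (P [set w | (1 / (4 * n%:R ^+ 2) <= comm_dev (X w) (Y w))%R] <=
   (80 / n%:R)%:E)%E.
Proof.
move=> n0 uX uY indep.
have x0 : 0 < n%:R :> R by rewrite ltr0n.
pose S := @frob_sphere R n : set (borel_mx R n).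
have mS : measurable S := @measurable_frob_sphere R n.
(* [Y] comes first because [xsection] fixes the first component. *)
pose YX w := (Y w, X w).
have mYX : measurable_fun setT YX by exact: measurable_fun_pair.
pose YXm : {mfun T >-> (borel_mx R n * borel_mx R n)%type} :=
  HB.pack YX (isMeasurableFun.Build _ _ _ _ _ mYX).
(* Requiring [S BA.1] empties the sections off the sphere, where [comm_dev_fiber] gives no bound. *)
pose Z := [set BA : borel_mx R n * borel_mx R n |
  S BA.1 /\ 1 / (4 * n%:R ^+ 2) <= comm_dev BA.2 BA.1].
have mZ : measurable Z.
  rewrite (_ : Z = fst @^-1` S `&`
    [set BA | 1 / (4 * n%:R ^+ 2) <= comm_dev BA.2 BA.1])//.
  apply: measurable_fun_le.
  - by rewrite -[X in measurable X]setTI; exact: measurable_fst.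
  - exact: measurable_cst.
  - apply: measurable_funTS; apply: measurable_comm_dev.
      exact: measurable_snd.
    exact: measurable_fst.
(* The two measures agree on rectangles, which determines the product measure. *)
have prodE : (distribution P Y \x distribution P X)%E Z = distribution P YXm Z.
  apply: product_measure_unique => // E F mE mF.
  rewrite /distribution /pushforward/= muleC -indep// setIC.
  by congr (P _).
have PZ : (P [set w | (1 / (4 * n%:R ^+ 2) <= comm_dev (X w) (Y w))%R] <=
    distribution P YXm Z)%E.
  have mYXZ : measurable (YX @^-1` Z).
    by rewrite -[X in measurable X]setTI; exact: (mYX measurableT Z mZ).
  have mYS : measurable (Y @^-1` (~` S)).
    rewrite -[X in measurable X]setTI; apply: measurable_funPT => //.
    exact: measurableC.
  apply: (@le_trans _ _ (P (YX @^-1` Z `|` Y @^-1` (~` S)))).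
    apply: le_measure; rewrite ?inE//.
    - rewrite -[X in measurable X]setTI; apply: measurable_fun_le => //.
      exact: measurable_comm_dev.
    - exact: measurableU.
    - by move=> w wb; have [SY|SY] := pselect (S (Y w)); [left|right].
  apply: le_trans (measureU2 _ _ _) _ => //.
  rewrite [X in (_ + X <= _)%E](_ : _ = 0%E) ?adde0//.
  exact: sphere_compl_measure0 uY.
apply: le_trans PZ _; rewrite -prodE /product_measure1/=.
have bg : sphere_bounded (fun B : borel_mx R n =>
    64 / n%:R + 16 / n%:R * \tr (B : 'M[R]_n) ^+ 2).
  apply: sphere_boundedD; first exact: sphere_bounded_cst.
  apply: sphere_boundedM; first exact: sphere_bounded_cst.
  exact: sphere_bounded_sqr_trace.
apply: (@le_trans _ _ (\int[distribution P Y]_(B in S)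
    (64 / n%:R + 16 / n%:R * \tr (B : 'M[R]_n) ^+ 2)%:E)%E).
  rewrite [leRHS]integral_mkcond; apply: ge0_le_integral => //.
  - exact: measurable_fun_xsection.
  - apply/(measurable_restrictT _ mS); apply/measurable_EFinP.
    by apply: measurable_funS bg.1.
  - move=> B _; rewrite patchE; case: ifPn => [|nSB].
      rewrite inE => SB; apply: le_trans (comm_dev_fiber n0 uX SB).
      apply: le_measure; rewrite ?inE.
      + exact: measurable_xsection.
      + rewrite -[X in measurable X]setTI; apply: measurable_fun_le => //.
        exact: measurable_comm_dev.
      + by move=> A; rewrite /xsection/= inE => -[].
    rewrite (_ : xsection Z B = set0) ?measure0//.
    apply/seteqP; split=> // A; rewrite /xsection/= inE => -[SB _].
    by case/negP: nSB; rewrite inE.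
rewrite EFin_sphere_mean// lee_fin.
have bt := @sphere_bounded_sqr_trace R n.
rewrite sphere_meanD; last 2 first.
- exact: sphere_bounded_cst.
- by apply: sphere_boundedM => //; exact: sphere_bounded_cst.
rewrite (sphere_mean_cst _ uY) sphere_meanZ//.
rewrite (sphere_mean_sqr_trace n0 uY).
have i1 : n%:R^-1 <= 1 :> R by rewrite invf_le1// ler1n.
have i0 : 0 <= n%:R^-1 :> R by rewrite invr_ge0 ltW.
nra.
Qed.

(** * Negative defects, the union bound and the limit *)

(** For [alpha = 1], a^2 + b^2 <= (a + b)^2 < c^2; for [alpha = 2] the two inequalities are the
    same. *)
Lemma powR_defect_sqr (R : realType) (alpha a b c : R) :
  alpha = 1 \/ alpha = 2 -> 0 <= a -> 0 <= b -> 0 <= c ->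
  a `^ alpha + b `^ alpha - c `^ alpha < 0 -> a ^+ 2 + b ^+ 2 < c ^+ 2.
Proof.
move=> [->|->] a0 b0 c0.
  by rewrite !powRr1// => h; nra.
by rewrite !(powR_mulrn 2)// => h; lra.
Qed.

(** Otherwise all three squared norms lie strictly between 3/(2n) and 5/(2n). The sum of two then
    exceeds 3/n, hence the third. *)
Lemma triangle_defect_lt0 (R : realType) (n : nat) (alpha : R)
    (A B C : borel_mx R n) :
  alpha = 1 \/ alpha = 2 -> (0 < n)%N -> triangle_defect alpha A B C < 0 ->
  [\/ 1 / (4 * n%:R ^+ 2) <= comm_dev A B, 1 / (4 * n%:R ^+ 2) <= comm_dev B C
    | 1 / (4 * n%:R ^+ 2) <= comm_dev A C].
Proof.
move=> a12 n0 /(powR_defect_sqr a12 (sqrtr_ge0 _) (sqrtr_ge0 _) (sqrtr_ge0 _)).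
have x0 : 0 < n%:R^-1 :> R by rewrite invr_gt0 ltr0n.
rewrite !sqr_frob_norm -!/(lie_mx _ _) /comm_dev.
have -> : 1 / (4 * n%:R ^+ 2) = n%:R^-1 ^+ 2 / 4 :> R.
  by field; rewrite pnatr_eq0 -lt0n.
move: x0 (frob_dot _ _) (frob_dot _ _) (frob_dot _ _).
move: (n%:R^-1) => x x0 a b c abc.
have [|ha] := leP (x ^+ 2 / 4) ((a - 2 * x) ^+ 2); first by constructor.
have [|hb] := leP (x ^+ 2 / 4) ((b - 2 * x) ^+ 2); first by constructor.
have [|hc] := leP (x ^+ 2 / 4) ((c - 2 * x) ^+ 2); first by constructor.
have near y : (y - 2 * x) ^+ 2 < x ^+ 2 / 4 -> 3 / 2 * x < y < 5 / 2 * x.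
  move=> hy; have : `|y - 2 * x| < x / 2.
    rewrite -[ltRHS]ger0_norm ?divr_ge0 ?ltW// -ltr_sqr ?nnegrE//.
    by rewrite !real_normK ?num_real//; lra.
  by rewrite ltr_norml => /andP[? ?]; apply/andP; split; lra.
move: (near _ ha) (near _ hb) (near _ hc) => /andP[? ?] /andP[? ?] /andP[? ?].
lra.
Qed.

Lemma measurable_comm_dist (R : realType) (n : nat) (alpha : R) d
    (T : measurableType d) (X Y : T -> borel_mx R n) :
  measurable_fun setT X -> measurable_fun setT Y ->
  measurable_fun setT (fun w => comm_dist alpha (X w : 'M[R]_n) (Y w)).
Proof.
move=> mX mY; rewrite /comm_dist.
apply: (measurableT_comp (measurable_powR alpha)).
under eq_fun do rewrite frob_normE.
apply: (measurableT_comp (continuous_measurable_fun (@sqrt_continuous R))).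
exact: measurable_lie_mx_dot.
Qed.

(** Union bound over the three pairs, 240 = 3 * 80; pairwise independence follows by taking one set
    to be [setT]. *)
Lemma triangle_defect_probability_le (R : realType) (n : nat) (alpha : R) d
    (T : measurableType d) (P : probability T R)
    (A B C : {RV P >-> borel_mx R n}) :
  alpha = 1 \/ alpha = 2 -> (0 < n)%N ->
  is_uniform_sphere (distribution P A) ->
  is_uniform_sphere (distribution P B) ->
  is_uniform_sphere (distribution P C) -> independent3 A B C ->
  (P [set w | (triangle_defect alpha (A w) (B w) (C w) < 0)%R] <=
   (240 / n%:R)%:E)%E.
Proof.
move=> a12 n0 uA uB uC indep.
pose dev (X Y : {RV P >-> borel_mx R n}) :=
  [set w | (1 / (4 * n%:R ^+ 2) <= comm_dev (X w) (Y w))%R].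
have mdev X Y : measurable (dev X Y).
  rewrite -[X in measurable X]setTI; apply: measurable_fun_le => //.
  exact: measurable_comm_dev.
have PAB : (P (dev A B) <= (80 / n%:R)%:E)%E.
  apply: comm_dev_probability_le => // E F mE mF.
  have := indep E F setT mE mF measurableT.
  by rewrite preimage_setT setIT probability_setT mule1.
have PBC : (P (dev B C) <= (80 / n%:R)%:E)%E.
  apply: comm_dev_probability_le => // E F mE mF.
  have := indep setT E F measurableT mE mF.
  by rewrite preimage_setT setTI probability_setT mul1e.
have PAC : (P (dev A C) <= (80 / n%:R)%:E)%E.
  apply: comm_dev_probability_le => // E F mE mF.
  have := indep E setT F mE measurableT mF.
  by rewrite preimage_setT setIT probability_setT mule1.
apply: (@le_trans _ _ (P (dev A B `|` dev B C `|` dev A C))).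
  apply: le_measure; rewrite ?inE.
  - rewrite (_ : [set _ | _] = ~` (setT `&`
        [set w | 0 <= triangle_defect alpha (A w) (B w) (C w)])); last first.
      by rewrite setTI; apply/seteqP; split=> w /=; rewrite ltNge => /negP.
    apply: measurableC; apply: measurable_fun_le => //.
    by apply: measurable_funB; [apply: measurable_funD|];
      exact: measurable_comm_dist.
  - by do 2! apply: measurableU => //.
  - move=> w /(triangle_defect_lt0 a12 n0)[?|?|?];
      by [left; left|left; right|right].
apply: le_trans (measureU2 _ _ _) _ => //; first exact: measurableU.
have -> : 240 / n%:R = 80 / n%:R + 80 / n%:R + 80 / n%:R :> R by ring.
rewrite !EFinD leeD//; apply: le_trans (measureU2 _ _ _) _ => //.
by rewrite leeD.
Qed.

Theorem theorem3p1 (R : realType) (alpha : R)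
    (d : nat -> measure_display)
    (Omega : forall n : nat, measurableType (d n))
    (P : forall n : nat, probability (Omega n) R)
    (A B C : forall n : nat, {RV (P n) >-> (borel_mx R n)}) :
  alpha = 1 \/ alpha = 2 ->
  (forall n : nat, (2 <= n)%N ->
    [/\ is_uniform_sphere (distribution (P n) (A n)),
        is_uniform_sphere (distribution (P n) (B n)),
        is_uniform_sphere (distribution (P n) (C n)) &
        independent3 (A n) (B n) (C n)]) ->
  P n [set w | triangle_defect alpha (A n w) (B n w) (C n w) < 0]
    @[n --> \oo] --> 0%E.
Proof.
move=> a12 H.
(* [harmonic n] is 1 / (n + 1), and n + 1 <= 2 n for n >= 1, so 240 / n <= 480 / (n + 1). *)
apply: (@squeeze_cvge _ _ _ _ (fun=> 0%E) _ (fun n => (480 * harmonic n)%:E)).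
- near=> n; apply/andP; split; first exact: measure_ge0.
  have n2 : (2 <= n)%N by near: n; exact: nbhs_infty_ge.
  have [uA uB uC indep] := H n n2; have n0 : (0 < n)%N by exact: leq_trans n2.
  apply: le_trans (triangle_defect_probability_le a12 n0 uA uB uC indep) _.
  rewrite lee_fin ler_pdivrMr ?ltr0n// /harmonic mulrAC ler_pdivlMr ?ltr0n//.
  by rewrite -natr1; have : 1 <= n%:R :> R by [rewrite ler1n]; lra.
- exact: cvg_cst.
- apply: cvg_EFin; first exact: nearW.
  rewrite -[X in _ --> X](mulr0 480); apply: cvgM; first exact: cvg_cst.
  exact: cvg_harmonic.
Unshelve. all: by end_near.
Qed.
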